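(* Let $\mathcal H$ be a separable real Hilbert space and let $\mathbf A,\mathbf B\in\mathcal B_1^+(\mathcal H)$ be covariance operators. Then either $\mathbf A\leadsto\mathbf B$ or $\mathbf B\leadsto\mathbf A$ holds (at least one of the two).
   Context: $\mathcal R(\cdot)$ denotes the range. $\mathcal B_1^+(\mathcal H)$ is the set of self-adjoint positive semidefinite trace-class operators on $\mathcal H$. For $\mathbf A,\mathbf B\in\mathcal B_1^+(\mathcal H)$, write $\mathbf A\leadsto\mathbf B$ if there exists an optimal pre-pushforward from $\mathbf A$ to $\mathbf B$, i.e. a (possibly unbounded) linear operator $\mathbf T:\mathcal R(\mathbf A^{1/2})\subset\overline{\mathcal R(\mathbf A)}\to\mathcal H$ such that $(\mathbf T\mathbf A^{1/2})(\mathbf T\mathbf A^{1/2})^*=\mathbf B$ and $\operatorname{tr}(\mathbf A^{1/2}\mathbf T\mathbf A^{1/2})=\operatorname{tr}(\mathbf T\mathbf A)=\operatorname{tr}[(\mathbf A^{1/2}\mathbf B\mathbf A^{1/2})^{1/2}]$. The relation $\mathbf B\leadsto\mathbf A$ is defined with the roles of $\mathbf A$ and $\mathbf B$ interchanged. *)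

(* Defs.v *)
From HB Require Import structures.
From mathcomp Require Import all_boot all_order all_algebra.
From mathcomp Require Import all_classical all_reals all_analysis.
Import Order.TTheory GRing.Theory Num.Theory.
Import numFieldNormedType.Exports.

Set Implicit Arguments.
Unset Strict Implicit.
Unset Printing Implicit Defensive.

Local Open Scope classical_set_scope.
Local Open Scope ring_scope.

Definition separable (T : topologicalType) :=
  exists2 D : set T, countable D & dense D.

(* A real Hilbert space is a complete normed module H together with a symmetric
   positive definite bilinear form dot that induces the norm of H. *)
Definition induces_norm (R : realType) (H : completeNormedModType R)
    (dot : {dot H for idfun}) :=
  forall x : H, dot x x = `|x| ^+ 2.

Section Operators.
Context (R : realType) (H : completeNormedModType R) (dot : {dot H for idfun}).
Implicit Types (K S T A B : H -> H) (E : set H).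

Definition bounded_op K := linear K /\ continuous K.

Definition self_adjoint K := forall x y, dot (K x) y = dot x (K y).

Definition psd_op K :=
  [/\ bounded_op K, self_adjoint K & forall x, 0 <= dot (K x) x].

(* The operator L with <K x, y> = <x, L y>. It exists and is unique when K is
   bounded; the default value 0 is only taken for other K. *)
Definition adjoint K : H -> H :=
  xget (fun=> 0) [set L : H -> H | forall x y, dot (K x) y = dot x (L y)].

(* The positive semidefinite square root. It exists and is unique when K is
   positive semidefinite; the default value 0 is only taken for other K. *)
Definition sqrt_op K : H -> H :=
  xget (fun=> 0) [set S : H -> H | psd_op S /\ S \o S = K].

Definition abs_op K : H -> H := sqrt_op (adjoint K \o K).

(* An orthonormal basis is a maximal orthonormal set. It is given as a set of
   vectors so that finite- and infinite-dimensional spaces are both covered. *)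
Definition orthonormal_basis E :=
  (forall e f, E e -> E f -> dot e f = (e == f)%:R) /\
  (forall x, (forall e, E e -> dot x e = 0) -> x = 0).

Definition trace_class K := bounded_op K /\
  exists2 E, orthonormal_basis E &
    (\esum_(e in E) (dot (abs_op K e) e)%:E < +oo)%E.

(* The trace of K, for K trace-class, is t. As -oo absorbs in \bar R and t is
   finite, the equation forces the diagonal of K to be absolutely summable. *)
Definition is_trace K (t : R) := trace_class K /\
  forall E, orthonormal_basis E ->
    let d := fun e : H => (dot (K e) e)%:E in
    (\esum_(e in E) d^\+ e - \esum_(e in E) d^\- e = t%:E)%E.

(* Elements of B_1^+(H). *)
Definition covariance_op A := psd_op A /\ trace_class A.

(* T stands for an operator with domain range (sqrt_op A): its values outside
   this subspace are irrelevant and no continuity of T is assumed. Boundedness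
   of T A^{1/2} is not a restriction: an operator defined on all of H whose
   adjoint is defined on all of H is bounded (Hellinger-Toeplitz). *)
Definition pre_pushforward A B T :=
  let G := T \o sqrt_op A in
  [/\ forall (a : R) x y, range (sqrt_op A) x -> range (sqrt_op A) y ->
        T (a *: x + y) = a *: T x + T y,
      bounded_op G
    & G \o adjoint G = B].

Definition optimal_pre_pushforward A B T :=
  let rA := sqrt_op A in
  pre_pushforward A B T /\
  exists t : R, [/\ is_trace (rA \o T \o rA) t,
                    is_trace (T \o A) t
                  & is_trace (sqrt_op (rA \o B \o rA)) t].

Definition leadsto A B := exists T, optimal_pre_pushforward A B T.

End Operators.

(* Main.v *)
Require Import Defs.
From HB Require Import structures.
From mathcomp Require Import all_boot all_order all_algebra.
From mathcomp Require Import all_classical all_reals all_analysis.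
From mathcomp Require Import ring lra.
Import Order.TTheory GRing.Theory Num.Theory.
Import numFieldNormedType.Exports.
Set Implicit Arguments.
Unset Strict Implicit.
Unset Printing Implicit Defensive.

Local Open Scope classical_set_scope.
Local Open Scope ring_scope.

(* Let rA and rB be the square roots of A and B, M = rB rA and S = |M|. An
   operator W which is isometric on the closure of ran rB, with range in the
   closure of ran rA, and such that W M is positive semidefinite, gives A ~> B:
   the square of W M is M^* W^* W M = M^* M, so W M = S, and T is defined by
   T (rA x) = rB (W^* x).
   The graph of the partial isometry M x |-> S x is contained, by Zorn's lemma,
   in a maximal linear isometric graph F between these two closures. By
   maximality the domain of F is dense in the closure of ran rB, or its range is
   dense in the closure of ran rA, since otherwise a pair of vectors orthogonal
   to the domain and to the range could be added. In the first case W extends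
   F; in the second, W extends the inverse of F, so that W S = M and
   W M^* = W S W^* is positive semidefinite, which gives B ~> A.
   Closures of subspaces are expressed as double orthogonal complements. *)

(** * Quadratic inequalities, linear maps and the inner product *)

Lemma discriminant_le (R : realType) (a b c : R) : 0 <= a -> 0 <= c ->
  (forall t, 0 <= a + 2 * b * t + c * t ^+ 2) -> b ^+ 2 <= a * c.
Proof.
move=> a0 c0 h; case: (eqVneq c 0) => [c_eq0 | c_neq0].
  case: (eqVneq b 0) => [-> | b_neq0]; first by nra.
  (* With [c = 0] the form is affine in [t], and here it takes the value -1. *)
  have := h (- (a + 1) / (2 * b)).
  have -> : a + 2 * b * (- (a + 1) / (2 * b)) = -1 by field.
  by rewrite c_eq0; lra.
have c_gt0 : 0 < c by rewrite lt_neqAle eq_sym c_neq0.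
(* The minimizer of the quadratic. *)
have := h (- b / c).
have -> : a + 2 * b * (- b / c) + c * (- b / c) ^+ 2 = (a * c - b ^+ 2) / c.
  by field.
by rewrite pmulr_lge0 ?invr_gt0 // subr_ge0.
Qed.

Section LinearMap.
Context (R : realType) (U V : lmodType R) (K : U -> V).
Hypothesis linK : linear K.

Lemma lin0 : K 0 = 0.
Proof. by have := linK (-1) 0 0; rewrite !scaleN1r !addNr. Qed.

Lemma linD x y : K (x + y) = K x + K y.
Proof. by have := linK 1 x y; rewrite !scale1r. Qed.

Lemma linZ a x : K (a *: x) = a *: K x.
Proof. by have := linK a x 0; rewrite !addr0 lin0 addr0. Qed.

Lemma linN x : K (- x) = - K x.
Proof. by rewrite -scaleN1r linZ scaleN1r. Qed.

Lemma linB x y : K (x - y) = K x - K y.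
Proof. by rewrite linD linN. Qed.

End LinearMap.

Section Hilbert.
Context (R : realType) (H : completeNormedModType R) (dot : {dot H for idfun}).
Hypothesis hdot : induces_norm dot.
Implicit Types (K L S T : H -> H) (V : set H).

Lemma dotC x y : dot x y = dot y x.
Proof. by rewrite hermC /= expr0 mul1r. Qed.

Lemma dotDl x y z : dot (x + y) z = dot x z + dot y z.
Proof. exact: linearDl. Qed.

Lemma dotDr x y z : dot z (x + y) = dot z x + dot z y.
Proof. exact: linearDr. Qed.

Lemma dotZl a x z : dot (a *: x) z = a * dot x z.
Proof. exact: linearZl_LR. Qed.

Lemma dotZr a x z : dot z (a *: x) = a * dot z x.
Proof. exact: linearZr_LR. Qed.

Lemma dotNl x z : dot (- x) z = - dot x z.
Proof. by rewrite -scaleN1r dotZl mulN1r. Qed.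

Lemma dotNr x z : dot z (- x) = - dot z x.
Proof. by rewrite -scaleN1r dotZr mulN1r. Qed.

Lemma dot0l z : dot 0 z = 0.
Proof. by rewrite -(scale0r 0) dotZl mul0r. Qed.

Lemma dot0r z : dot z 0 = 0.
Proof. by rewrite dotC dot0l. Qed.

Lemma dotBl x y z : dot (x - y) z = dot x z - dot y z.
Proof. by rewrite dotDl dotNl. Qed.

Lemma dotBr x y z : dot z (x - y) = dot z x - dot z y.
Proof. by rewrite dotDr dotNr. Qed.

Definition dotE := (dotDl, dotDr, dotNl, dotNr, dotZl, dotZr, dot0l, dot0r).

Lemma dot_suml (I : Type) (s : seq I) (P : pred I) (F : I -> H) z :
  dot (\sum_(i <- s | P i) F i) z = \sum_(i <- s | P i) dot (F i) z.
Proof.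
exact: (big_morph (fun x => dot x z) (fun x y => dotDl x y z) (dot0l z)).
Qed.

Lemma dotxx_ge0 x : 0 <= dot x x.
Proof. by rewrite hdot sqr_ge0. Qed.

Lemma dotxx_eq0 x : dot x x = 0 -> x = 0.
Proof. by rewrite hdot => /eqP; rewrite sqrf_eq0 normr_eq0 => /eqP. Qed.

Lemma dot_inj x y : (forall z, dot x z = dot y z) -> x = y.
Proof.
by move=> h; apply/eqP; rewrite -subr_eq0; apply/eqP/dotxx_eq0; rewrite dotBl h subrr.
Qed.

(** Cauchy-Schwarz, from the discriminant of [t |-> |x + t y|^2]. *)
Lemma dot_normM x y : `|dot x y| <= `|x| * `|y|.
Proof.
rewrite -(@ler_pXn2r _ 2) ?nnegrE ?mulr_ge0 // exprMn real_normK ?num_real //.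
rewrite -!hdot; apply: discriminant_le => [||t]; try exact: dotxx_ge0.
suff -> : dot x x + 2 * dot x y * t + dot y y * t ^+ 2
  = dot (x + t *: y) (x + t *: y) by exact: dotxx_ge0.
by rewrite !dotE (dotC y x); ring.
Qed.

Lemma normD_sq x y : `|x + y| ^+ 2 = `|x| ^+ 2 + 2 * dot x y + `|y| ^+ 2.
Proof. by rewrite -!hdot !dotE (dotC y x); ring. Qed.

Lemma normB_sq x y : `|x - y| ^+ 2 = `|x| ^+ 2 - 2 * dot x y + `|y| ^+ 2.
Proof. by rewrite -!hdot !dotE (dotC y x); ring. Qed.

End Hilbert.

(** * Riesz representation and closures of subspaces *)

Lemma le_small_eq0 (R : realType) (x c : R) : 0 <= x -> 0 <= c ->
  (forall d, 0 < d -> d < 1 -> x <= c * d) -> x = 0.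
Proof.
move=> x0 c0 h; apply/eqP; rewrite eq_le x0 andbT leNgt; apply/negP => xp.
have cx : 0 < 2 * (c + x) by lra.
(* For this [d] the product [c * d] is at most [x / 2]. *)
have d0 : 0 < x / (2 * (c + x)) by rewrite divr_gt0.
have d1 : x / (2 * (c + x)) < 1 by rewrite ltr_pdivrMr //; lra.
have := h _ d0 d1; rewrite mulrA ler_pdivlMr //; nra.
Qed.

Section Riesz.
Context (R : realType) (H : completeNormedModType R) (dot : {dot H for idfun}).
Hypothesis hdot : induces_norm dot.
Implicit Types (K L S T : H -> H) (V : set H).

Definition linear_subspace V :=
  V 0 /\ forall (a : R) x y, V x -> V y -> V (a *: x + y).

Definition orth V : set H := [set w | forall v, V v -> dot v w = 0].

Lemma orth_orth_eq0 V x : orth V x -> orth (orth V) x -> x = 0.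
Proof. by move=> Vx VVx; apply: (dotxx_eq0 hdot); apply: VVx. Qed.

Lemma orth_lin V (a : R) x y : orth V x -> orth V y -> orth V (a *: x + y).
Proof. by move=> Vx Vy v Vv; rewrite !dotE Vx // Vy // mulr0 addr0. Qed.

Lemma orth_sub V x y : orth V x -> orth V y -> orth V (x - y).
Proof. by move=> Vx Vy v Vv; rewrite !dotE Vx // Vy // subr0. Qed.

Lemma sub_orth_orth V : V `<=` orth (orth V).
Proof. by move=> v Vv w Vw; rewrite dotC; apply: Vw. Qed.

Lemma orthS U V : U `<=` V -> orth V `<=` orth U.
Proof. by move=> UV w Vw u Uu; apply: Vw; apply: UV. Qed.

Lemma cauchy_limit (u : nat -> H) :
  (forall e, 0 < e -> exists N, forall n, (N <= n)%N -> `|u N - u n| < e) ->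
  exists z : H, u @ \oo --> z.
Proof.
move=> hu; suff : cauchy (u @ \oo) by move=> /cauchy_cvgP; exists (lim (u @ \oo)).
apply: cauchy_exP => e e0; have [N hN] := hu e e0.
exists (u N), N => // n /= Nn; rewrite -ball_normE /=; exact: hN.
Qed.

(* [z] is the limit of a minimizing sequence in [V] of [|v|^2 - 2 phi v]. *)
Lemma riesz V (phi : H -> R) (C : R) : linear_subspace V ->
  (forall (a : R) x y, V x -> V y -> phi (a *: x + y) = a * phi x + phi y) ->
  (forall v, V v -> `|phi v| <= C * `|v|) ->
  exists z, (forall v, V v -> dot v z = phi v) /\
    (forall e, 0 < e -> exists2 v, V v & `|z - v| < e).
Proof.
move=> [V0 Vlin] phi_lin phi_le.
pose J v := dot v v - 2 * phi v; pose m := inf (J @` V).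
have phi0 : phi 0 = 0.
  by have := phi_lin (-1) 0 0 V0 V0; rewrite scaler0 addr0 mulN1r addNr.
have hasinf : has_inf (J @` V).
  split; first by exists (J 0), 0.
  (* Completing the square: [J v >= |v|^2 - 2 C |v| >= - C^2]. *)
  exists (- C ^+ 2) => _ [v Vv <-]; rewrite /J hdot.
  have := phi_le v Vv; have := ler_norm (phi v); have := sqr_ge0 (`|v| - C); nra.
have mJ v : V v -> m <= J v by move=> Vv; apply: ge_inf; [case: hasinf | exists v].
have : forall n : nat, exists v, V v /\ J v < m + n.+1%:R^-1.
  move=> n; have n0 : 0 < n.+1%:R^-1 :> R by rewrite invr_gt0.
  by have [_ [v Vv <-] ?] := inf_adherent n0 hasinf; exists v.
move=> /boolp.choice [v hv]; have Vv n : V (v n) by case: (hv n).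
have {hv} Jv n : J (v n) < m + n.+1%:R^-1 by case: (hv n).
have small (e : R) : 0 < e -> exists N, forall n, (N <= n)%N -> n.+1%:R^-1 < e.
  by move=> e0; have [N _ hN] := near_infty_natSinv_lt (PosNum e0); exists N.
have [e e0|z vz] := @cauchy_limit v.
  (* By the parallelogram identity [|v N - v n|^2] is [2 J (v N) + 2 J (v n)] minus four times [J]
     at the midpoint, which is at least [m]; two excesses below [e^2 / 4] therefore suffice. *)
  have [|N hN] := small (e ^+ 2 / 4); first by rewrite divr_gt0 ?exprn_gt0.
  exists N => n Nn; rewrite -(@ltr_pXn2r _ 2) ?nnegrE ?(ltW e0) // (normB_sq hdot).
  have Vw1 : V (2^-1 *: v n + 0) by exact: Vlin.
  have Vw : V (2^-1 *: v N + (2^-1 *: v n + 0)) by exact: Vlin.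
  have := mJ _ Vw; rewrite /J !phi_lin // phi0 !dotE (dotC _ (v n) (v N)).
  have := Jv N; have := Jv n; have := hN _ Nn; have := hN _ (leqnn N).
  by move: (n.+1%:R^-1) (N.+1%:R^-1) => a b; rewrite /J -!hdot; lra.
have approx (e : R) : 0 < e -> exists n, `|z - v n| < e /\ n.+1%:R^-1 < e.
  move=> e0; have [N1 hN1] := small e e0.
  move/cvgrPdist_lt: vz => /(_ e e0) [N2 _ hN2].
  exists (maxn N1 N2); split; first by apply: hN2; rewrite /= leq_maxr.
  by apply: hN1; rewrite leq_maxl.
exists z; split=> [w Vw | e /approx[n [] ? _]]; last by exists (v n).
apply/eqP; rewrite -subr_eq0 -sqrf_eq0; apply/eqP.
(* The 4 comes from [(a - c)^2 <= 2 (a - b)^2 + 2 (b - c)^2] with [a = dot w z], [b = dot w (v n)],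
   [c = phi w]; both squares on the right are at most [|w|^2 d]. *)
apply: (@le_small_eq0 _ _ (4 * `|w| ^+ 2)) => [||d d0 d1].
- exact: sqr_ge0.
- by rewrite mulr_ge0 ?sqr_ge0.
have [n [zn nd]] := approx d d0.
(* [J] at [t w + v n] is at least [m] for every [t]; the discriminant of this quadratic in [t]
   bounds the first variation. *)
have Dn : (dot w (v n) - phi w) ^+ 2 <= (J (v n) - m) * dot w w.
  apply: discriminant_le => [||t]; rewrite ?(dotxx_ge0 hdot) ?subr_ge0 ?mJ //.
  have := mJ _ (Vlin t _ _ Vw (Vv n)).
  rewrite /J phi_lin // !dotE (dotC _ (v n) w); nra.
have zvn : dot w z - dot w (v n) = dot w (z - v n) by rewrite dotBr.
have : dot w (z - v n) ^+ 2 <= `|w| ^+ 2 * d.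
  rewrite -(real_normK (num_real (dot w (z - v n)))).
  apply: (@le_trans _ _ ((`|w| * `|z - v n|) ^+ 2)).
    by rewrite ler_pXn2r ?nnegrE ?mulr_ge0 // dot_normM.
  rewrite exprMn ler_wpM2l ?sqr_ge0 //; have := normr_ge0 (z - v n); nra.
have : (dot w (v n) - phi w) ^+ 2 <= `|w| ^+ 2 * d.
  apply: (le_trans Dn); rewrite hdot mulrC ler_wpM2l ?sqr_ge0 //.
  by move: (Jv n) nd; move: (n.+1%:R^-1) => i; lra.
rewrite -zvn -[4 * _ * d]mulrA; move: (dot w z) (dot w (v n)) (phi w) => a b c.
move: (`|w| ^+ 2 * d) => q.
by move=> h1 h2; have := sqr_ge0 (a - 2 * b + c); nra.
Qed.

(* Membership in [orth (orth V)], the closure of [V], makes [z] unique. *)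
Lemma riesz_closure V (phi : H -> R) (C : R) : linear_subspace V -> 0 <= C ->
  (forall (a : R) x y, V x -> V y -> phi (a *: x + y) = a * phi x + phi y) ->
  (forall v, V v -> `|phi v| <= C * `|v|) ->
  exists z, [/\ orth (orth V) z, forall v, V v -> dot v z = phi v & `|z| <= C].
Proof.
move=> subV C0 phi_lin phi_le; have [z [zV apz]] := riesz subV phi_lin phi_le.
have approx w : (forall v, V v -> `|dot v w| <= C * `|v|) ->
    forall d, 0 < d -> `|dot z w| <= C * (`|z| + d) + d * `|w|.
  move=> Vw d d0; have [v Vv zv] := apz d d0.
  rewrite -(subrK v z) dotDl; apply: (le_trans (ler_normD _ _)); rewrite addrC.
  apply: lerD; last first.
    by apply: (le_trans (dot_normM hdot _ _)); rewrite ler_wpM2r // ltW.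
  apply: (le_trans (Vw _ Vv)); rewrite ler_wpM2l // subrK.
  by rewrite -lerBlDl (le_trans (lerB_dist _ _)) // distrC ltW.
exists z; split=> //.
  move=> w Vw; rewrite dotC; apply/eqP; rewrite -normr_eq0; apply/eqP.
  apply: (@le_small_eq0 _ _ `|w|) => // d d0 _.
  have [v Vv zv] := apz d d0; rewrite -(subrK v z) dotDl (Vw v) // addr0.
  by apply: (le_trans (dot_normM hdot _ _)); rewrite mulrC ler_wpM2l // ltW.
have zw d : 0 < d -> `|dot z z| <= C * (`|z| + d) + d * `|z|.
  by apply: approx => v Vv; rewrite zV // phi_le.
rewrite leNgt; apply/negP => Cz.
(* [zw] rearranges to [|z| (|z| - C) <= (C + |z|) d], while [C < |z|] makes the left side
   positive. *)
suff : `|z| * (`|z| - C) = 0 by nra.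
apply: (@le_small_eq0 _ _ (C + `|z|)) => [||d d0 _]; try by nra.
have := zw d d0; rewrite ger0_norm ?(dotxx_ge0 hdot) // hdot; nra.
Qed.

End Riesz.

(** * Bounded operators, adjoints and partial isometries *)

Section Operators.
Context (R : realType) (H : completeNormedModType R) (dot : {dot H for idfun}).
Hypothesis hdot : induces_norm dot.
Implicit Types (K L S T : H -> H) (V : set H) (F : set (H * H)).

Lemma bounded_opI K (C : R) :
  linear K -> (forall x, `|K x| <= C * `|x|) -> bounded_op K.
Proof.
move=> linK KC; split=> //.
pose mK := GRing.isLinear.Build R H H *:%R K linK.
pose f : {linear H -> H} := HB.pack K mK.
apply: (@bounded_linear_continuous _ _ _ f); apply/linear_boundedP.
exists C; split=> [|r Cr x]; first exact: num_real.
by apply: (le_trans (KC x)); rewrite ler_wpM2r // ltW.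
Qed.

Lemma bounded_opP K :
  bounded_op K -> exists2 C : R, 0 <= C & forall x, `|K x| <= C * `|x|.
Proof.
move=> [linK contK].
pose mK := GRing.isLinear.Build R H H *:%R K linK.
pose f : {linear H -> H} := HB.pack K mK.
have /linear_boundedP[M [_ hM]] : bounded_near f (nbhs 0).
  exact/linear_bounded_continuous.
exists (`|M| + 1) => [|x]; first by rewrite addr_ge0.
by apply: hM; rewrite (le_lt_trans (ler_norm M)) // ltrDl.
Qed.

Lemma bounded_op_comp K L : bounded_op K -> bounded_op L -> bounded_op (K \o L).
Proof.
move=> bK bL; have [C C0 KC] := bounded_opP bK; have [D D0 LD] := bounded_opP bL.
apply: (@bounded_opI _ (C * D)) => [a x y | x] /=.
  by rewrite (proj1 bL) (proj1 bK).
by apply: (le_trans (KC _)); rewrite -mulrA ler_wpM2l.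
Qed.

Lemma bounded_opZD (a : R) K L :
  bounded_op K -> bounded_op L -> bounded_op (fun x => a *: K x + L x).
Proof.
move=> bK bL; have [C C0 KC] := bounded_opP bK; have [D D0 LD] := bounded_opP bL.
apply: (@bounded_opI _ (`|a| * C + D)) => [b x y | x].
  rewrite (proj1 bL) (proj1 bK) !scalerDr !scalerA mulrC -!addrA; congr (_ + _).
  by rewrite addrCA.
rewrite mulrDl; apply: (le_trans (ler_normD _ _)); apply: lerD => //.
by rewrite normrZ -mulrA ler_wpM2l.
Qed.

Lemma bounded_op_id : bounded_op (@id H).
Proof. by apply: (@bounded_opI _ 1) => // x; rewrite mul1r. Qed.

(** A relation, so that adjoints of composites and combinations are computed without unfolding the
    choice in [adjoint]. *)
Definition adjoint_pair K L :=
  [/\ bounded_op K, bounded_op L & forall x y, dot (K x) y = dot x (L y)].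

Lemma adjoint_pair_sym K L : adjoint_pair K L -> adjoint_pair L K.
Proof. by move=> [bK bL KL]; split=> // x y; rewrite dotC -KL dotC. Qed.

Lemma adjoint_pair_comp K L K' L' : adjoint_pair K K' -> adjoint_pair L L' ->
  adjoint_pair (K \o L) (L' \o K').
Proof.
move=> [bK bK' KK'] [bL bL' LL'].
by split=> [||x y]; rewrite /= ?KK' ?LL' //; exact: bounded_op_comp.
Qed.

Lemma adjoint_pairZD (a : R) K L K' L' : adjoint_pair K K' -> adjoint_pair L L' ->
  adjoint_pair (fun x => a *: K x + L x) (fun x => a *: K' x + L' x).
Proof.
move=> [bK bK' KK'] [bL bL' LL'].
by split=> [||x y]; rewrite ?dotE ?KK' ?LL' //; exact: bounded_opZD.
Qed.

Lemma psd_op_adjoint_pair K : psd_op dot K -> adjoint_pair K K.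
Proof. by move=> [bK sK _]. Qed.

(** [|L x|^2 = dot (K (L x)) x <= C |L x| |x|], and [|L x|] cancels. *)
Lemma adjoint_pair_norm_le K L (C : R) : 0 <= C -> adjoint_pair K L ->
  (forall x, `|K x| <= C * `|x|) -> forall x, `|L x| <= C * `|x|.
Proof.
move=> C0 [_ _ KL] KC x; have : `|L x| ^+ 2 <= (C * `|x|) * `|L x|.
  rewrite -hdot -KL; apply: (le_trans (ler_norm _)).
  by apply: (le_trans (dot_normM hdot _ _)); rewrite mulrAC ler_wpM2r.
have := normr_ge0 (L x); rewrite le_eqVlt => /orP[/eqP <- _|L0].
  by rewrite mulr_ge0.
by rewrite expr2 ler_pM2r.
Qed.

(** [L y] is the Riesz vector of [x |-> dot (K x) y] on the whole space; the bound in
    [riesz_closure] makes [L] bounded. *)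
Lemma adjoint_exists K : bounded_op K -> exists L, adjoint_pair K L.
Proof.
move=> bK; have [C C0 KC] := bounded_opP bK.
have /boolp.choice[L hL] : forall y, exists z,
    (forall x, dot (K x) y = dot x z) /\ `|z| <= C * `|y|.
  move=> y.
  have [|||v _|z [_ hz zC]] :=
    @riesz_closure _ _ _ hdot setT (fun x => dot (K x) y) (C * `|y|).
  - by [].
  - by rewrite mulr_ge0.
  - by move=> a u v _ _; rewrite (proj1 bK) !dotE.
  - by apply: (le_trans (dot_normM hdot _ _)); rewrite mulrAC ler_wpM2r.
  by exists z; split=> // x; rewrite hz.
exists L; split=> [//||x y]; last by case: (hL y).
apply: (@bounded_opI _ C) => [a x y | x]; last by case: (hL x).
have KL u v : dot (K u) v = dot u (L v) by case: (hL v).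
by apply: (dot_inj hdot) => z; rewrite dotC -KL !dotE !KL !(dotC _ _ z).
Qed.

Lemma adjoint_unique K L : (forall x y, dot (K x) y = dot x (L y)) ->
  adjoint dot K = L.
Proof.
(* The existence of [L] excludes the default value of [adjoint]. *)
move=> KL; have hA : forall x y, dot (K x) y = dot x (adjoint dot K y).
  by rewrite /adjoint; case: xgetP => [L' -> //|/(_ L)].
by apply/funext => y; apply: (dot_inj hdot) => x; rewrite !(dotC _ _ x) -hA KL.
Qed.

Definition graph_dom F : set H := [set x | exists y, F (x, y)].
Definition graph_ran F : set H := [set y | exists x, F (x, y)].

(** Partial isometries are encoded as graphs: they are ordered by inclusion, chains have unions, and
    inversion swaps the components. Linearity and norm preservation make the graph single-valued and
    injective. *)
Definition isometric_graph F := [/\ F (0, 0),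
  forall (a : R) x y x' y', F (x, x') -> F (y, y') -> F (a *: x + y, a *: x' + y') &
  forall x x', F (x, x') -> `|x| = `|x'| ].

Lemma isometric_graph_dot F x y x' y' : isometric_graph F ->
  F (x, x') -> F (y, y') -> dot x y = dot x' y'.
Proof.
move=> [_ linF isoF] Fx Fy.
have := isoF _ _ (linF 1 _ _ _ _ Fx Fy); rewrite !scale1r => h.
have := normD_sq hdot x y; have := normD_sq hdot x' y'.
by rewrite h (isoF _ _ Fx) (isoF _ _ Fy); lra.
Qed.

(* [W] is the continuous extension of [F] by [0] on the orthogonal complement
   of its domain; its adjoint [W'] is the one constructed by Riesz. *)
Lemma isometry_extension F : isometric_graph F -> exists W W',
  [/\ adjoint_pair W W', forall x, `|W x| <= `|x| &
   [/\ forall x y, F (x, y) -> W x = y,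
      forall x, orth dot (orth dot (graph_dom F)) x -> W' (W x) = x &
      forall y, orth dot (graph_ran F) y -> W' y = 0]].
Proof.
move=> isoF; have [F0 linF normF] := isoF; pose D := graph_dom F.
have /boolp.choice[f hf] : forall x, exists y, D x -> F (x, y).
  by move=> x; have [[y Fxy]|?] := pselect (D x); [exists y | exists 0].
have fE x y : F (x, y) -> y = f x.
  move=> Fxy; have Fx : F (x, f x) by apply: hf; exists y.
  have := normF _ _ (linF (-1) _ _ _ _ Fxy Fx).
  rewrite !scaleN1r addNr normr0 => /esym/eqP; rewrite normr_eq0 addrC subr_eq0.
  by move=> /eqP.
have subD : linear_subspace D.
  split; first by exists 0.
  by move=> a x y [x' Fx] [y' Fy]; exists (a *: x' + y'); apply: linF.
have /boolp.choice[W' hW'] : forall y, exists z,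
    [/\ orth dot (orth dot D) z, forall x, D x -> dot x z = dot (f x) y & `|z| <= `|y| ].
  move=> y; apply: (riesz_closure hdot subD) => // [a u v Du Dv | v Dv].
    by rewrite -(fE _ _ (linF a _ _ _ _ (hf _ Du) (hf _ Dv))) !dotE.
  by apply: (le_trans (dot_normM hdot _ _)); rewrite -(normF _ _ (hf _ Dv)) mulrC.
have W'D y : orth dot (orth dot D) (W' y) by case: (hW' y).
have W'E y x : D x -> dot x (W' y) = dot (f x) y.
  by have [_ h _] := hW' y; exact: h.
have linW' : linear W'.
  (* Two vectors of the closure of [D] with the same inner products against [D] coincide. *)
  move=> a x y; apply/eqP; rewrite -subr_eq0; apply/eqP.
  apply: (@orth_orth_eq0 _ _ _ hdot D).
    by move=> v Dv; rewrite !dotE !W'E // !dotE subrr.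
  by apply: orth_sub => //; apply: orth_lin.
have bW' : bounded_op W'.
  by apply: (@bounded_opI _ 1) => // x; rewrite mul1r; case: (hW' x).
have [W W'W_adj] := adjoint_exists bW'.
have [bW _ W'W] := adjoint_pair_sym W'W_adj.
have WF x y : F (x, y) -> W x = y.
  move=> Fxy; apply: (dot_inj hdot) => z; rewrite W'W W'E; last by exists y.
  by rewrite -(fE _ _ Fxy).
have W'WD x : D x -> W' (W x) = x.
  move=> Dx; apply/eqP; rewrite -subr_eq0; apply/eqP.
  apply: (@orth_orth_eq0 _ _ _ hdot D).
    move=> v Dv; rewrite dotBr W'E // (WF _ _ (hf _ Dx)).
    by rewrite -(isometric_graph_dot isoF (hf _ Dv) (hf _ Dx)) subrr.
  by apply: orth_sub => //; exact: sub_orth_orth.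
exists W, W'; split; [exact: adjoint_pair_sym | | split=> // [x Dx | y ry]].
- move=> x; rewrite -[leRHS]mul1r; apply: (adjoint_pair_norm_le _ W'W_adj) => // y.
  by rewrite mul1r; case: (hW' y).
(* [E] is self-adjoint and vanishes on [D], so its range lies in [orth D] and it vanishes on the
   closure of [D]. *)
- pose E := fun x => W' (W x) - x.
  have symE u v : dot (E u) v = dot u (E v).
    by rewrite dotBl dotBr (dotC _ (W' _)) -W'W dotC W'W.
  apply/eqP; rewrite -subr_eq0; apply/eqP/(dot_inj hdot) => z.
  rewrite -/(E x) symE dot0l dotC; apply: Dx => v Dv.
  by rewrite -symE /E W'WD // subrr dot0l.
- apply: (@orth_orth_eq0 _ _ _ hdot D) => // x Dx; rewrite W'E //.
  by apply: ry; exists x; exact: hf.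
Qed.

End Operators.

(** * Square roots of positive semidefinite operators *)

Section PositiveOperators.
Context (R : realType) (H : completeNormedModType R) (dot : {dot H for idfun}).
Hypothesis hdot : induces_norm dot.
Implicit Types (K L S T X : H -> H) (V : set H) (F : set (H * H)).

Lemma psd_op_CS K x y : psd_op dot K ->
  dot (K x) y ^+ 2 <= dot (K x) x * dot (K y) y.
Proof.
move=> [[linK _] symK K0]; apply: discriminant_le => // t.
suff -> : dot (K x) x + 2 * dot (K x) y * t + dot (K y) y * t ^+ 2
   = dot (K (x + t *: y)) (x + t *: y) by exact: K0.
by rewrite (linD linK) (linZ linK) !dotE (symK y x) (dotC _ y); ring.
Qed.

(** [psd_op_CS] with [y = K x] gives [|K x|^4 <= dot (K x) x * c |K x|^2]. This turns convergence of
    quadratic forms into convergence in norm. *)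
Lemma psd_op_norm_le K (c : R) x : 0 <= c -> psd_op dot K ->
  (forall y, dot (K y) y <= c * `|y| ^+ 2) -> `|K x| ^+ 2 <= c * dot (K x) x.
Proof.
move=> c0 psdK Kc; have [_ _ K0] := psdK; have := psd_op_CS x (K x) psdK.
rewrite hdot; have := Kc (K x); have := K0 x; have := sqr_ge0 `|K x|.
rewrite le_eqVlt => /orP[/eqP <-|].
  by move=> Kx0 _ _; rewrite mulr_ge0.
move=> Kx0 Kx KKx h; rewrite -(ler_pM2r Kx0) -expr2; apply: (le_trans h).
by rewrite mulrAC [leRHS]mulrC ler_wpM2l.
Qed.

Lemma psd_op_le K (C : R) x :
  (forall x, `|K x| <= C * `|x|) -> dot (K x) x <= C * `|x| ^+ 2.
Proof.
move=> KC; apply: (le_trans (ler_norm _)); apply: (le_trans (dot_normM hdot _ _)).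
by rewrite expr2 mulrA ler_wpM2r.
Qed.

Lemma psd_op_eq0 K x : psd_op dot K -> dot (K x) x = 0 -> K x = 0.
Proof.
move=> psdK Kx0; have [bK _ _] := psdK; have [C C0 KC] := bounded_opP bK.
have := psd_op_norm_le x C0 psdK (fun y => psd_op_le y KC); rewrite Kx0 mulr0 => Kx.
by apply/eqP; rewrite -normr_eq0 -sqrf_eq0 eq_le Kx sqr_ge0.
Qed.

Lemma psd_opZD (a : R) K L : 0 <= a -> psd_op dot K -> psd_op dot L ->
  psd_op dot (fun x => a *: K x + L x).
Proof.
move=> a0 [bK sK K0] [bL sL L0]; split; first exact: bounded_opZD.
  by move=> x y; rewrite !dotE sK sL.
by move=> x; rewrite !dotE addr_ge0 // mulr_ge0.
Qed.

Lemma psd_op_0 : psd_op dot (fun=> 0).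
Proof.
split.
- apply: (@bounded_opI _ _ _ 0) => [a x y|x]; first by rewrite scaler0 addr0.
  by rewrite normr0 mul0r.
- by move=> x y; rewrite !dotE.
- by move=> x; rewrite dotE.
Qed.

(** Half of the factors move to the other side: an even power gives a squared norm, an odd one the
    form of [X] at an iterate. *)
Lemma psd_op_iter X n : psd_op dot X -> psd_op dot (iter n X).
Proof.
move=> [bX sX X0].
have bI k : bounded_op (iter k X).
  by elim: k => [|k IH] /=; [exact: bounded_op_id | exact: (bounded_op_comp bX IH)].
have sI k : self_adjoint dot (iter k X).
  by elim: k => [|k IH] x y //=; rewrite sX IH -iterSr.
split=> // x; rewrite -(odd_double_half n) -addnn; move: n./2 => q.
case: (odd n); last by rewrite add0n iterD sI (dotxx_ge0 hdot).
by rewrite add1n -addnS iterD iterS sI.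
Qed.

(** A composite of positive semidefinite operators need not be positive semidefinite; polynomials in
    one [X] with nonnegative coefficients are stable under composition, so positivity of the
    iterates is tracked in this class. *)
Inductive nneg_poly X : (H -> H) -> Prop :=
| nneg_poly0 : nneg_poly X (fun=> 0)
| nneg_polyD (a : R) n K : 0 <= a -> nneg_poly X K ->
    nneg_poly X (fun x => a *: iter n X x + K x).

Lemma nneg_poly_psd X K : psd_op dot X -> nneg_poly X K -> psd_op dot K.
Proof.
move=> psdX; elim=> [|a n L a0 _ psdL]; first exact: psd_op_0.
by apply: psd_opZD => //; apply: psd_op_iter.
Qed.

Lemma nneg_poly_ZD X (a : R) K L : 0 <= a -> nneg_poly X K -> nneg_poly X L ->
  nneg_poly X (fun x => a *: K x + L x).
Proof.
move=> a0; elim=> [|b n K' b0 _ IH] pL.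
  by rewrite (_ : (fun _ => _) = L) //; apply/funext => x; rewrite scaler0 add0r.
rewrite (_ : (fun _ => _) = fun x => (a * b) *: iter n X x + (a *: K' x + L x)).
  by apply: nneg_polyD; [rewrite mulr_ge0 | exact: IH].
by apply/funext => x; rewrite scalerDr scalerA addrA.
Qed.

Lemma nneg_poly_self X : nneg_poly X X.
Proof.
have := nneg_polyD 1 ler01 (nneg_poly0 X).
by congr nneg_poly; apply/funext => x; rewrite scale1r addr0.
Qed.

Lemma nneg_poly_comp X K L : linear X -> nneg_poly X K -> nneg_poly X L ->
  nneg_poly X (K \o L).
Proof.
move=> linX; elim=> [|a n K' a0 _ IH] pL; first exact: nneg_poly0.
have {}IH := IH pL; apply: (@nneg_poly_ZD _ a (iter n X \o L) (K' \o L)) => //.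
elim: pL {IH} => [|b m L' b0 _ IH].
  rewrite (_ : _ \o _ = fun=> 0); first exact: nneg_poly0.
  by apply/funext => x /=; elim: n => //= n ->; rewrite (lin0 linX).
rewrite (_ : _ \o _ = fun x => b *: iter (n + m) X x + (iter n X \o L') x).
  exact: nneg_polyD.
by apply/funext => x /=; elim: n {IH} => //= n ->; rewrite linX.
Qed.

Lemma dot_cvg (u : nat -> H) z y : u @ \oo --> z ->
  (fun n => dot (u n) y) @ \oo --> dot z y.
Proof.
move=> uz; apply/cvgrPdist_le => e e0; have y1 : 0 < `|y| + 1.
  by rewrite ltr_wpDl.
move/cvgrPdist_le: uz => /(_ _ (divr_gt0 e0 y1)) uz.
near=> n; rewrite -dotBl; apply: (le_trans (dot_normM hdot _ _)).
apply: (@le_trans _ _ (e / (`|y| + 1) * `|y|)).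
  by rewrite ler_wpM2r //; near: n.
by rewrite mulrAC ler_pdivrMr // ler_wpM2l ?(ltW e0) // lerDl.
Unshelve. all: by end_near. Qed.

(* For [0 <= X <= 1] the iterates increase to [Y = 1 - sqrt (1 - X)], the
   solution of [2 Y = X + Y^2]: their differences are polynomials in [X] with
   nonnegative coefficients, and such polynomials are positive semidefinite. *)
Fixpoint sqrt_iter X n : H -> H :=
  if n is n'.+1 then fun x => 2^-1 *: (X x + sqrt_iter X n' (sqrt_iter X n' x))
  else fun=> 0.

Lemma sqrt_iter_poly X n : linear X -> nneg_poly X (sqrt_iter X n).
Proof.
move=> linX; elim: n => [|n IH] /=; first exact: nneg_poly0.
rewrite (_ : (fun _ => _) = fun x => 2^-1 *: X x +
   (2^-1 *: (sqrt_iter X n \o sqrt_iter X n) x + 0)).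
  apply: nneg_poly_ZD => //; first exact: nneg_poly_self.
  by apply: nneg_poly_ZD; [|exact: nneg_poly_comp|exact: nneg_poly0].
by apply/funext => x; rewrite scalerDr addr0.
Qed.

(** With [D] the previous difference, the next one is half of [sqrt_iter X n.+1 \o D] plus half of
    [D \o sqrt_iter X n]: the mixed terms of the difference of squares cancel. *)
Lemma sqrt_iter_incr X n : psd_op dot X ->
  nneg_poly X (fun x => sqrt_iter X n.+1 x - sqrt_iter X n x).
Proof.
move=> psdX; have [[linX _] _ _] := psdX.
have linY k : linear (sqrt_iter X k).
  by have [[]] := nneg_poly_psd psdX (sqrt_iter_poly k linX).
elim: n => [|n IH].
  rewrite (_ : (fun _ => _) = fun x => 2^-1 *: X x + 0).
    by apply: nneg_poly_ZD; [|exact: nneg_poly_self|exact: nneg_poly0].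
  by apply/funext => x /=; rewrite subr0 !addr0.
set D := fun x => _ in IH.
rewrite (_ : (fun _ => _) = fun x => 2^-1 *: (sqrt_iter X n.+1 \o D) x
   + (2^-1 *: (D \o sqrt_iter X n) x + 0)).
  apply: nneg_poly_ZD => //.
    by apply: nneg_poly_comp => //; exact: sqrt_iter_poly.
  apply: nneg_poly_ZD => //; last exact: nneg_poly0.
  by apply: nneg_poly_comp => //; exact: sqrt_iter_poly.
apply/funext => x; rewrite addr0 -scalerDr /D.
rewrite (_ : (sqrt_iter X n.+1 \o _) x = sqrt_iter X n.+1 (sqrt_iter X n.+1 x)
   - sqrt_iter X n.+1 (sqrt_iter X n x)); last exact: (linB (linY n.+1)).
rewrite (_ : (_ \o sqrt_iter X n) x = sqrt_iter X n.+1 (sqrt_iter X n x) -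
  sqrt_iter X n (sqrt_iter X n x)) // addrA subrK.
rewrite [in LHS](_ : sqrt_iter X n.+2 x =
  2^-1 *: (X x + sqrt_iter X n.+1 (sqrt_iter X n.+1 x))) //.
rewrite [X in _ - X](_ : _ = 2^-1 *: (X x + sqrt_iter X n (sqrt_iter X n x))) //.
by rewrite -scalerBr opprD addrACA subrr add0r.
Qed.

Lemma sqrt_iter_mono X n m : psd_op dot X -> (n <= m)%N ->
  psd_op dot (fun x => sqrt_iter X m x - sqrt_iter X n x).
Proof.
move=> psdX /subnK <-; elim: (m - n)%N => [|k IH].
  rewrite (_ : (fun _ => _) = fun=> 0); first exact: psd_op_0.
  by apply/funext => x; rewrite subrr.
have := psd_opZD ler01 (nneg_poly_psd psdX (sqrt_iter_incr (k + n) psdX)) IH.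
by congr psd_op; apply/funext => x; rewrite scale1r addrA subrK.
Qed.

End PositiveOperators.

(** * Convergence of the iteration; existence and uniqueness of the square root *)

Section SquareRoot.
Context (R : realType) (H : completeNormedModType R) (dot : {dot H for idfun}).
Hypothesis hdot : induces_norm dot.
Implicit Types (K L S T X : H -> H) (V : set H) (F : set (H * H)).

Lemma sqrt_iter_norm_le X n x : (forall y, `|X y| <= `|y|) ->
  `|sqrt_iter X n x| <= `|x|.
Proof.
move=> X1; elim: n x => [|n IH] x /=; first by rewrite normr0.
rewrite normrZ ger0_norm // mulrC ler_pdivrMr // mulr_natr mulr2n.
apply: (le_trans (ler_normD _ _)); apply: lerD => //.
by apply: (le_trans (IH _)).
Qed.

Lemma sqrt_iter_commute X L n x : linear L -> (forall y, L (X y) = X (L y)) ->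
  L (sqrt_iter X n x) = sqrt_iter X n (L x).
Proof.
move=> linL LX; elim: n x => [|n IH] x /=; first by rewrite (lin0 linL).
by rewrite (linZ linL) (linD linL) LX !IH.
Qed.

(** The numbers [a n] increase and are bounded by [|x|^2]. The differences of iterates have forms
    bounded by 2, so [psd_op_norm_le] bounds the squared distances by [2 (a n - a N)]. *)
Lemma sqrt_iter_cvg X x : psd_op dot X -> (forall y, `|X y| <= `|y|) ->
  exists z : H, (fun n => sqrt_iter X n x) @ \oo --> z.
Proof.
move=> psdX X1; pose a n := dot (sqrt_iter X n x) x.
have a_le n m : (n <= m)%N -> a n <= a m.
  move=> nm; have [_ _ /(_ x)] := sqrt_iter_mono hdot psdX nm.
  by rewrite dotBl subr_ge0.
have a_ub n : a n <= `|x| ^+ 2.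
  apply: (le_trans (ler_norm _)); apply: (le_trans (dot_normM hdot _ _)).
  by rewrite expr2 ler_wpM2r // sqrt_iter_norm_le.
have hasup : has_sup (range a).
  by split; [exists (a 0%N), 0%N | exists (`|x| ^+ 2) => _ [n _ <-]].
apply: cauchy_limit => e e0.
have e2 : 0 < e ^+ 2 / 2 by rewrite divr_gt0 ?exprn_gt0.
have [_ [N _ <-] aN] := sup_adherent e2 hasup; exists N => n Nn.
rewrite distrC -(@ltr_pXn2r _ 2) ?nnegrE ?(ltW e0) //.
have psdD := sqrt_iter_mono hdot psdX Nn.
have an : a n <= sup (range a) by apply: sup_upper_bound => //; exists n.
apply: (le_lt_trans (@psd_op_norm_le _ _ _ hdot _ 2 x _ psdD _)) => // [y|].
  apply: (@psd_op_le _ _ _ hdot (fun z => sqrt_iter X n z - sqrt_iter X N z)) => {}y.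
  apply: (le_trans (ler_normB _ _)).
  by rewrite mulr_natl mulr2n; apply: lerD; exact: sqrt_iter_norm_le.
by rewrite dotBl -/(a n) -/(a N); lra.
Qed.

Lemma sqrt_iter_limit X : psd_op dot X -> (forall y, `|X y| <= `|y|) ->
  exists Y, [/\ psd_op dot Y, forall y, `|Y y| <= `|y|,
    forall x, 2 *: Y x = X x + Y (Y x) &
    forall L, bounded_op L -> (forall y, L (X y) = X (L y)) ->
      forall y, L (Y y) = Y (L y)].
Proof.
move=> psdX X1; have /boolp.choice[Y hY] := fun x => sqrt_iter_cvg x psdX X1.
have [[linX _] _ _] := psdX.
have psdY n : psd_op dot (sqrt_iter X n).
  exact/(nneg_poly_psd hdot psdX)/sqrt_iter_poly.
have Yle y : `|Y y| <= `|y|.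
  apply/ler_addgt0Pr => e e0; move/cvgrPdist_lt: (hY y) => /(_ _ e0)[n _ hn].
  rewrite -(subrK (sqrt_iter X n y) (Y y)) addrC; apply: (le_trans (ler_normD _ _)).
  by apply: lerD; [exact: sqrt_iter_norm_le | apply/ltW/hn => /=].
have uniq_lim (u : nat -> H) (z w : H) : u @ \oo --> z -> u @ \oo --> w -> z = w.
  by move=> uz uw; exact: (cvg_unique _ uz uw).
have linYn n : linear (sqrt_iter X n) by have [[]] := psdY n.
have linY : linear Y.
  move=> a x y; apply: (uniq_lim _ _ _ (hY _)).
  rewrite (_ : (fun n => _) = (fun n => a *: sqrt_iter X n x + sqrt_iter X n y)).
    by apply: cvgD => //; exact: cvgZr.
  by apply/funext => n; rewrite linYn.
(* The iterates are linear contractions, so the inner limit may be taken inside the outer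
   iterate. *)
have YY x : (fun n => sqrt_iter X n (sqrt_iter X n x)) @ \oo --> Y (Y x).
  apply/cvgrPdist_lt => e e0; have e2 : 0 < e / 2 by rewrite divr_gt0.
  move/cvgrPdist_lt: (hY x) => /(_ _ e2) Yx.
  move/cvgrPdist_lt: (hY (Y x)) => /(_ _ e2) YYx.
  near=> n; rewrite -(subrK (sqrt_iter X n (Y x)) (Y (Y x))) -addrA -(linB (linYn n)).
  rewrite (splitr e); apply: (le_lt_trans (ler_normD _ _)); apply: ltrD.
    by near: n.
  by apply: (le_lt_trans (sqrt_iter_norm_le _ _ X1)); near: n.
exists Y; split=> //.
- split.
  + by apply: (@bounded_opI _ _ _ 1) => // x; rewrite mul1r.
  + move=> x y; have := dot_cvg hdot (y := y) (hY x); have := dot_cvg hdot (y := x) (hY y).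
    rewrite (_ : (fun n => dot _ x) = (fun n => dot (sqrt_iter X n x) y)).
      by rewrite (dotC dot x); move=> u1 u2; exact: (cvg_unique _ u2 u1).
    by apply/funext => n; have [_ -> _] := psdY n; rewrite dotC.
  + move=> x; rewrite leNgt; apply/negP => Yx0.
    have /cvgrPdist_lt/(_ (- dot (Y x) x)) := dot_cvg hdot (y := x) (hY x).
    rewrite oppr_gt0 => /(_ Yx0) [n _ /(_ n (leqnn n))] /=; have [_ _ /(_ x)] := psdY n.
    by rewrite ltr_norml; lra.
- move=> x; apply: (uniq_lim (fun n => 2 *: sqrt_iter X n.+1 x)).
    by apply: cvgZr; rewrite (cvg_shiftS (fun n => sqrt_iter X n x)).
  rewrite (_ : (fun n => _) = (fun n => X x + sqrt_iter X n (sqrt_iter X n x))).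
    by apply: cvgD => //; exact: cvg_cst.
  by apply/funext => n /=; rewrite scalerA mulfV ?scale1r.
- move=> L [linL contL] LX y.
  apply: (uniq_lim (fun n => L (sqrt_iter X n y))).
    by apply: continuous_cvg => //; exact: contL.
  rewrite (_ : (fun n => _) = (fun n => sqrt_iter X n (L y))) //.
  by apply/funext => n; exact: sqrt_iter_commute.
Unshelve. all: by end_near. Qed.

(** For [c] above a bound of [K], [X = 1 - K / c] lies between 0 and 1, and [S = sqrt c (1 - Y)] has
    square [c (1 - 2 Y + Y^2) = c (1 - X) = K]. The commutation clause serves uniqueness. *)
Lemma sqrt_op_exists K : psd_op dot K -> exists S, [/\ psd_op dot S, S \o S = K &
  forall L, bounded_op L -> (forall y, L (K y) = K (L y)) ->
    forall y, L (S y) = S (L y)].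
Proof.
move=> psdK; have [bK symK K0] := psdK; have [linK _] := bK.
have [C C0 KC] := bounded_opP bK; pose c := C + 1.
have c0 : 0 < c by rewrite /c; lra.
pose X x := (- c^-1) *: K x + x.
have psdX : psd_op dot X.
  split; first exact: (bounded_opZD _ bK (@bounded_op_id _ _)).
    by move=> x y; rewrite /X !dotE symK.
  move=> x; rewrite /X !dotE mulNr addrC subr_ge0 ler_pdivrMl // hdot.
  apply: (le_trans (psd_op_le hdot x KC)).
  by rewrite ler_wpM2r ?sqr_ge0 // /c; lra.
have X1 x : `|X x| <= `|x|.
  have Xle y : dot (X y) y <= 1 * `|y| ^+ 2.
    rewrite mul1r -hdot /X !dotE mulNr gerDr oppr_le0.
    by rewrite mulr_ge0 // invr_ge0 ltW.
  rewrite -(@ler_pXn2r _ 2) ?nnegrE //.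
  apply: (le_trans (psd_op_norm_le hdot x ler01 psdX Xle)).
  by rewrite mul1r (le_trans (Xle x)) // mul1r.
have [Y [psdY Y1 YX YL]] := sqrt_iter_limit psdX X1.
have [bY symY Y0] := psdY; have [linY _] := bY.
pose s := Num.sqrt c; have ss : s * s = c by rewrite -expr2 sqr_sqrtr // ltW.
pose S x := (- s) *: Y x + s *: x.
have bs : bounded_op (fun x : H => s *: x).
  by have := bounded_opZD (s - 1) (@bounded_op_id _ H) (@bounded_op_id _ H);
     congr bounded_op; apply/funext => x; rewrite scalerBl scale1r subrK.
have bS : bounded_op S by exact: bounded_opZD.
exists S; split.
- split=> [//|x y|x]; first by rewrite /S !dotE symY.
  rewrite /S !dotE mulNr addrC -mulrBr mulr_ge0 ?sqrtr_ge0 // subr_ge0 hdot.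
  rewrite -[leRHS]mul1r; apply: (psd_op_le hdot) => y; by rewrite mul1r.
- apply/funext => x /=.
  have -> : S (S x) = c *: (Y (Y x) - 2 *: Y x + x).
    rewrite {1}/S /S (linD linY) !(linZ linY) !scalerDr scalerN !scalerA -ss.
    rewrite mulrNN mulrN mulNr -!addrA; congr (_ + _).
    by rewrite addrA -scalerDl -scaleNr; congr (_ *: _ + _); ring.
  rewrite YX opprD addrCA subrr addr0 /X opprD scaleNr opprK subrK.
  by rewrite scalerA mulfV ?scale1r // gt_eqF.
- move=> L [linL contL] LK y; have LX z : L (X z) = X (L z).
    by rewrite /X (linD linL) (linZ linL) LK.
  by rewrite /S (linD linL) !(linZ linL) (YL L).
Qed.

(** Commuting roots are equal by [root_eq]. Every root commutes with its square, hence with the root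
    [Q] built by [sqrt_op_exists], so [S] and [T] both equal [Q]. *)
Lemma sqrt_op_unique S T : psd_op dot S -> psd_op dot T ->
  S \o S = T \o T -> S = T.
Proof.
suff root_eq U : psd_op dot U -> forall W, psd_op dot W ->
    (forall x, W (W x) = U (U x)) -> (forall y, W (U y) = U (W y)) -> W = U.
  move=> psdS psdT ST.
  have psdK : psd_op dot (S \o S).
    have [bS sS S0] := psdS; split; first exact: bounded_op_comp.
      by move=> x y /=; rewrite !sS.
    by move=> x /=; rewrite sS (dotxx_ge0 hdot).
  have [Q [psdQ QQ QL]] := sqrt_op_exists psdK.
  have QE L : psd_op dot L -> L \o L = S \o S -> Q = L.
    move=> psdL LS; have LL x : L (L x) = S (S x) by rewrite -[LHS]/((L \o L) x) LS.
    have QQx x : Q (Q x) = S (S x) by rewrite -[LHS]/((Q \o Q) x) QQ.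
    apply: (root_eq L psdL Q psdQ) => [x|y]; first by rewrite QQx LL.
    by apply/esym/QL; [case: psdL | move=> z /=; rewrite -!LL].
  by rewrite -(QE S) // -(QE T).
move=> psdU W psdW WU comm; apply/funext => x.
have [[linU _] sU U0] := psdU; have [[linW _] sW W0] := psdW.
pose y := W x - U x.
(* [(W + U) y = W^2 x - U^2 x = 0] by commutation; both forms are nonnegative, so [W y = U y = 0],
   whence [dot y y = dot x (W y - U y) = 0]. *)
have y0 : dot (W y) y + dot (U y) y = 0.
  rewrite -dotDl.
  have -> : W y + U y = 0; last by rewrite dot0l.
  by rewrite /y (linB linW) (linB linU) WU comm addrA subrK subrr.
have Wy : W y = 0 by apply: (psd_op_eq0 hdot psdW); have := W0 y; have := U0 y; lra.
have Uy : U y = 0 by apply: (psd_op_eq0 hdot psdU); have := W0 y; have := U0 y; lra.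
apply/eqP; rewrite -subr_eq0 -/y; apply/eqP/(dotxx_eq0 hdot).
by rewrite {1}/y dotBl sW sU Wy Uy dot0r subrr.
Qed.

Lemma sqrt_opP K : psd_op dot K ->
  psd_op dot (sqrt_op dot K) /\ forall x, sqrt_op dot K (sqrt_op dot K x) = K x.
Proof.
move=> /sqrt_op_exists[S [psdS SS _]].
have [psdQ QQ] : psd_op dot (sqrt_op dot K) /\ sqrt_op dot K \o sqrt_op dot K = K.
  by rewrite /sqrt_op; case: xgetP => [Q -> //|/(_ S)[]].
by split=> // x; rewrite -[LHS]/((sqrt_op dot K \o sqrt_op dot K) x) QQ.
Qed.

Lemma sqrt_op_eq K S : psd_op dot S -> (forall x, S (S x) = K x) ->
  sqrt_op dot K = S.
Proof.
move=> psdS SK; have SS : S \o S = K by apply/funext.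
rewrite /sqrt_op; case: xgetP => [Q -> [psdQ QQ]|/(_ S)[] //].
by apply: sqrt_op_unique => //; rewrite QQ SS.
Qed.

End SquareRoot.

(** * Hilbert-Schmidt operators and traces *)

Section HilbertSchmidt.
Context (R : realType) (H : completeNormedModType R) (dot : {dot H for idfun}).
Hypothesis hdot : induces_norm dot.
Implicit Types (K L S T X : H -> H) (E : set H).

Definition span_proj (s : seq H) (x : H) : H := \sum_(e <- s) dot x e *: e.

Section OrthonormalSeq.
Variables (E : set H) (s : seq H).
Hypotheses (basisE : orthonormal_basis dot E) (uniq_s : uniq s).
Hypothesis sE : {in s, forall e, E e}.

Lemma dot_seq e f : e \in s -> f \in s -> dot e f = (e == f)%:R.
Proof. by move=> /sE Ee /sE Ef; rewrite (proj1 basisE). Qed.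

Lemma dot_span_proj x f : f \in s -> dot (span_proj s x) f = dot x f.
Proof.
move=> fs; rewrite dot_suml (bigD1_seq f) //= dotZl dot_seq // eqxx mulr1.
rewrite big1_seq ?addr0 // => e /andP[ef es].
by rewrite dotZl dot_seq // (negbTE ef) mulr0.
Qed.

Lemma span_proj_linear : linear (span_proj s).
Proof.
move=> a x y; rewrite /span_proj scaler_sumr -big_split /=; apply: eq_bigr => e _.
by rewrite !dotE scalerDl scalerA.
Qed.

Lemma span_proj_id f : f \in s -> span_proj s f = f.
Proof.
move=> fs; rewrite /span_proj (bigD1_seq f) //= dot_seq // eqxx scale1r.
rewrite big1_seq ?addr0 // => e /andP[ef es].
by rewrite dot_seq // eq_sym (negbTE ef) scale0r.
Qed.

(** Serves both halves of Parseval: [y = x] gives Bessel's inequality, and a [y] fixed by the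
    projection bounds the missing mass by a distance to the span. *)
Lemma norm_sub_span_proj x y : `|x - span_proj s y| ^+ 2 =
  `|x| ^+ 2 - \sum_(e <- s) dot x e ^+ 2 + \sum_(e <- s) (dot x e - dot y e) ^+ 2.
Proof.
rewrite (normB_sq hdot) -(hdot (span_proj s y)) {2}/span_proj dot_suml.
rewrite (dotC _ x) /span_proj dot_suml -/(span_proj s y) mulr_sumr -!addrA; congr (_ + _).
rewrite -!sumrN -!big_split /=; apply: eq_big_seq => e es.
by rewrite !dotZl (dotC _ e (span_proj _ _)) dot_span_proj // (dotC _ e x); ring.
Qed.

End OrthonormalSeq.

Lemma span_proj_sub E (s t : seq H) v : orthonormal_basis dot E ->
  uniq t -> {in t, forall e, E e} -> {subset s <= t} -> span_proj s v = v ->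
  span_proj t v = v.
Proof.
move=> bE ut tE st sv.
have linP := span_proj_linear t.
have h : span_proj t (\sum_(e <- s) dot v e *: e)
   = \sum_(e <- s) dot v e *: span_proj t e.
  elim: (s) => [|e l IH]; first by rewrite !big_nil (lin0 linP).
  by rewrite !big_cons (linD linP) (linZ linP) IH.
rewrite -{1}sv [X in span_proj t X]/span_proj h -[RHS]sv /span_proj.
apply: eq_big_seq => e es.
by rewrite -/(span_proj t e) (@span_proj_id E) //; apply: st.
Qed.

Lemma parseval E x : orthonormal_basis dot E ->
  \esum_(e in E) (dot x e ^+ 2)%:E = (`|x| ^+ 2)%:E.
Proof.
move=> bE; apply/eqP; rewrite eq_le; apply/andP; split.
  apply: ub_ereal_sup => _ [F [finF FE] <-].
  rewrite fsbig_finite // sumEFin lee_fin.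
  rewrite -subr_ge0.
  have := norm_sub_span_proj bE (finmap.fset_uniq (fset_set F)) _ x x.
  have -> : \sum_(e <- finmap.enum_fset (fset_set F)) (dot x e - dot x e) ^+ 2 = 0.
    by apply: big1 => e _; rewrite subrr expr0n.
  rewrite addr0 => <-; first exact: sqr_ge0.
  by move=> e; rewrite in_fset_set // inE => /FE.
(* The span of [E]: vectors fixed by the projection onto a finite subfamily. *)
pose V := [set v : H | exists s : seq H,
  [/\ uniq s, {in s, forall e, E e} & span_proj s v = v]].
have subV : linear_subspace V.
  split; first by exists [::]; split=> //; rewrite /span_proj big_nil.
  move=> a u v [s [us sE su]] [t [ut tE tv]]; exists (undup (s ++ t)).
  have stE : {in undup (s ++ t), forall e, E e}.
    by move=> e; rewrite mem_undup mem_cat => /orP[/sE|/tE].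
  split; [exact: undup_uniq | exact: stE |].
  rewrite span_proj_linear.
  rewrite (@span_proj_sub E s _ u) ?undup_uniq //; last first.
    by move=> e es; rewrite mem_undup mem_cat es.
  rewrite (@span_proj_sub E t _ v) ?undup_uniq //.
  by move=> e es; rewrite mem_undup mem_cat es orbT.
have [||z [zV zapprox]] := @riesz _ _ _ hdot V (fun v => dot v x) `|x| subV.
- by move=> a u v _ _; rewrite !dotE.
- by move=> v _; rewrite mulrC; exact: dot_normM.
(* [x - z] is orthogonal to [E], so it vanishes by maximality; hence [x] is a limit of vectors of
   the span. *)
have xz : x - z = 0.
  apply: (proj2 bE) => e Ee; rewrite dotBl !(dotC _ _ e) zV ?subrr //.
  exists [:: e]; split=> // [f|]; first by rewrite inE => /eqP ->.
  by rewrite /span_proj big_seq1 (proj1 bE) // eqxx scale1r.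
move/subr0_eq: xz => xz; rewrite -xz in zapprox.
apply/lee_addgt0Pr => e e0.
have [|v [s [us sE sv]] xv] := zapprox (Num.sqrt e); first by rewrite sqrtr_gt0.
apply: (@le_trans _ _ ((\sum_(e <- s) dot x e ^+ 2)%:E + e%:E)%E); last first.
  rewrite leeD2r //; apply: esum_ge; exists [set` s].
    by split; [exact: finite_seq | move=> f /= /sE].
  by rewrite -fsbig_seq // sumEFin.
rewrite -EFinD lee_fin.
have := norm_sub_span_proj bE us sE x v; rewrite sv.
have : `|x - v| ^+ 2 <= e.
  by rewrite -(sqr_sqrtr (ltW e0)) ler_pXn2r ?nnegrE ?sqrtr_ge0 // ltW.
have : 0 <= \sum_(e <- s) (dot x e - dot v e) ^+ 2.
  by apply: sumr_ge0 => *; exact: sqr_ge0.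
by lra.
Qed.

Lemma esum_swap (I J : set H) (a : H -> H -> \bar R) :
  (forall i j, (0 <= a i j)%E) ->
  \esum_(i in I) \esum_(j in J) a i j = \esum_(j in J) \esum_(i in I) a i j.
Proof.
move=> a0; rewrite !esum_esum //.
rewrite (@reindex_esum _ _ _ (J `*`` fun=> I) _ (fun p : H * H => (p.2, p.1))) //.
split=> [[i j] [] //|[i j] [k l] _ _ [-> ->] //|[i j] [Ii Jj]].
by exists (j, i).
Qed.

(** By Parseval both sides are the double sum of [dot (K e) f ^+ 2], in the two orders of summation.
    Allowing two bases also yields independence of the basis. *)
Lemma hs_adjoint E F K L : orthonormal_basis dot E -> orthonormal_basis dot F ->
  adjoint_pair dot K L ->
  \esum_(e in E) (`|K e| ^+ 2)%:E = \esum_(f in F) (`|L f| ^+ 2)%:E.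
Proof.
move=> bE bF [_ _ KL].
under eq_esum do rewrite -(parseval _ bF).
under [RHS]eq_esum do rewrite -(parseval _ bE).
rewrite esum_swap; last by move=> *; rewrite lee_fin sqr_ge0.
by apply: eq_esum => f _; apply: eq_esum => e _; rewrite KL dotC.
Qed.

End HilbertSchmidt.

(** * Products of Hilbert-Schmidt operators and their traces *)

Section TraceClass.
Context (R : realType) (H : completeNormedModType R) (dot : {dot H for idfun}).
Hypothesis hdot : induces_norm dot.
Implicit Types (K L S T X P Q : H -> H) (E : set H).

(** The square of the usual Hilbert-Schmidt norm, possibly infinite. *)
Definition hs_norm K E : \bar R := \esum_(e in E) (`|K e| ^+ 2)%:E.

Definition hilbert_schmidt K :=
  forall E, orthonormal_basis dot E -> (hs_norm K E < +oo)%E.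

Lemma hs_norm_ge0 K E : (0 <= hs_norm K E)%E.
Proof. by apply: esum_ge0 => e _; rewrite lee_fin sqr_ge0. Qed.

Lemma hs_norm_basis E F K : orthonormal_basis dot E -> orthonormal_basis dot F ->
  bounded_op K -> hs_norm K E = hs_norm K F.
Proof.
move=> bE bF /(adjoint_exists hdot)[L KL].
by rewrite /hs_norm (hs_adjoint hdot bE bE KL) -(hs_adjoint hdot bF bE KL).
Qed.

Lemma hilbert_schmidt_basis E K : orthonormal_basis dot E -> bounded_op K ->
  (hs_norm K E < +oo)%E -> hilbert_schmidt K.
Proof. by move=> bE bK KE F bF; rewrite (hs_norm_basis bF bE bK). Qed.

Lemma hilbert_schmidt_adjoint K L : adjoint_pair dot K L ->
  hilbert_schmidt K -> hilbert_schmidt L.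
Proof.
by move=> KL hK E bE; rewrite /hs_norm -(hs_adjoint hdot bE bE KL); apply: hK.
Qed.

Lemma hilbert_schmidt_le K P : (forall x, `|K x| <= `|P x|) ->
  hilbert_schmidt P -> hilbert_schmidt K.
Proof.
move=> KP hP E bE; apply: le_lt_trans (hP E bE); apply: le_esum => e _.
by rewrite lee_fin ler_pXn2r ?nnegrE.
Qed.

Lemma hs_sum_lty E P Q : orthonormal_basis dot E ->
  hilbert_schmidt P -> hilbert_schmidt Q ->
  (\esum_(e in E) (`|P e| ^+ 2 + `|Q e| ^+ 2)%:E < +oo)%E.
Proof.
move=> bE hP hQ; under eq_esum do rewrite EFinD.
rewrite esumD => [|e _|e _]; try by rewrite lee_fin sqr_ge0.
by apply: lte_add_pinfty; [exact: hP | exact: hQ].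
Qed.

Lemma hilbert_schmidt_half P Q (s : R) : `|s| <= 1 ->
  hilbert_schmidt P -> hilbert_schmidt Q ->
  hilbert_schmidt (fun x => 2^-1 *: (s *: P x + Q x)).
Proof.
move=> s1 hP hQ E bE.
apply: le_lt_trans (hs_sum_lty bE hP hQ); apply: le_esum => e _.
rewrite lee_fin normrZ exprMn ger0_norm // (normD_sq hdot) normrZ exprMn dotZl.
have := normB_sq hdot (s *: P e) (Q e); rewrite normrZ exprMn dotZl.
have := sqr_ge0 `|s *: P e - Q e|; have := sqr_ge0 `|P e|; have := sqr_ge0 `|Q e|.
have : `|s| ^+ 2 <= 1 by rewrite expr_le1.
by nra.
Qed.

(** Polar decomposition: [W] carries [P (Q x)] to [S x] with [S = |P Q|], so
    [dot (S e) e = dot (Q e) (P' (W' e))] is at most [|Q e|^2 + |P' (W' e)|^2], and both terms are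
    summable. *)
Lemma trace_class_comp P Q P' Q' :
  adjoint_pair dot P P' -> adjoint_pair dot Q Q' ->
  hilbert_schmidt P -> hilbert_schmidt Q ->
  (exists E, orthonormal_basis dot E) -> trace_class dot (P \o Q).
Proof.
move=> PP QQ hP hQ [E bE]; have PQ := adjoint_pair_comp PP QQ.
have [bK bK' KK'] := PQ; split=> //; exists E => //.
rewrite /abs_op (adjoint_unique hdot KK').
have psdKK : psd_op dot ((Q' \o P') \o (P \o Q)).
  split; first exact: bounded_op_comp.
    by move=> x y; rewrite dotC -KK' dotC -KK'.
  by move=> x; rewrite dotC -KK' (dotxx_ge0 hdot).
have [psdS SS] := sqrt_opP hdot psdKK; move: (sqrt_op _ _) psdS SS => S psdS SS.
have [[linS _] symS S0] := psdS; have [linK _] := bK.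
pose F : set (H * H) := [set p | exists x, p = ((P \o Q) x, S x)].
have isoF : isometric_graph F.
  split; first by exists 0; rewrite (lin0 linS) (lin0 linK).
    move=> a x y x' y' [u [-> ->]] [v [-> ->]]; exists (a *: u + v).
    by rewrite linS linK.
  move=> x x' [u [-> ->]]; apply/eqP.
  rewrite -(@eqrXn2 _ 2) // -!hdot symS SS dotC.
  by rewrite dotC [X in _ == X]/= -KK'.
have [W [W' [WW W1 [WF _ _]]]] := isometry_extension hdot isoF.
have WK x : W ((P \o Q) x) = S x by apply: WF; exists x.
have hW : hilbert_schmidt (P' \o W').
  apply: (hilbert_schmidt_adjoint (adjoint_pair_comp WW PP)).
  by apply: hilbert_schmidt_le hP => x; exact: W1.
apply: le_lt_trans (hs_sum_lty bE hQ hW); apply: le_esum => e _.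
rewrite lee_fin -WK /=; have [_ _ ->] := WW; have [_ _ ->] := PP.
have := normB_sq hdot (Q e) (P' (W' e)); have := sqr_ge0 `|Q e - P' (W' e)|.
have := sqr_ge0 `|Q e|; have := sqr_ge0 `|P' (W' e)|; lra.
Qed.

(** Both sums are finite and independent of the basis, so their difference, computed on [E0], is the
    trace in every basis. *)
Lemma is_trace_polar K U V E0 : orthonormal_basis dot E0 -> trace_class dot K ->
  bounded_op U -> bounded_op V -> hilbert_schmidt U -> hilbert_schmidt V ->
  (forall x, dot (K x) x = `|U x| ^+ 2 - `|V x| ^+ 2) ->
  is_trace dot K (fine (hs_norm U E0) - fine (hs_norm V E0)).
Proof.
move=> bE0 trK bU bV hU hV KUV; split=> // E bE d.
have dE : d = fun e => ((`|U e| ^+ 2)%:E - (`|V e| ^+ 2)%:E)%E.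
  by apply/funext => e; rewrite /d KUV EFinB.
rewrite dE esumB.
- rewrite -/(hs_norm U E) -/(hs_norm V E) (hs_norm_basis bE bE0 bU).
  rewrite (hs_norm_basis bE bE0 bV) EFinB !fineK // ge0_fin_numE ?hs_norm_ge0 //.
    exact: hV.
  exact: hU.
- rewrite /summable; under eq_esum do rewrite gee0_abs ?lee_fin ?sqr_ge0 //.
  exact: hU.
- rewrite /summable; under eq_esum do rewrite gee0_abs ?lee_fin ?sqr_ge0 //.
  exact: hV.
- by move=> e _; rewrite lee_fin sqr_ge0.
- by move=> e _; rewrite lee_fin sqr_ge0.
Qed.

(* By polarization, [tr PQ] is the difference of the squared Hilbert-Schmidt
   norms of [(Q + P^* )/2] and [(Q - P^* )/2], and those of [tr QP] are the
   squared norms of their adjoints. *)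
Lemma is_trace_comp P Q P' Q' :
  adjoint_pair dot P P' -> adjoint_pair dot Q Q' ->
  hilbert_schmidt P -> hilbert_schmidt Q ->
  (exists E, orthonormal_basis dot E) ->
  exists t, is_trace dot (P \o Q) t /\ is_trace dot (Q \o P) t.
Proof.
move=> PP QQ hP hQ exE; have [E bE] := exE.
have hP' := hilbert_schmidt_adjoint PP hP; have hQ' := hilbert_schmidt_adjoint QQ hQ.
have idp : adjoint_pair dot (fun=> 0) (fun=> 0).
  exact/psd_op_adjoint_pair/psd_op_0.
pose comb (s : R) (K L : H -> H) x := 2^-1 *: (s *: K x + L x).
have combP s : adjoint_pair dot (comb s P' Q) (comb s P Q').
  have := adjoint_pairZD 2^-1 (adjoint_pairZD s (adjoint_pair_sym PP) QQ) idp.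
  by congr adjoint_pair; apply/funext => x; rewrite addr0.
have combE K L x : dot (K x) (L x) =
    `|comb 1 L K x| ^+ 2 - `|comb (-1) L K x| ^+ 2.
  by rewrite -!hdot /comb !dotE (dotC _ (K x)); field.
exists (fine (hs_norm (comb 1 P' Q) E) - fine (hs_norm (comb (-1) P' Q) E)).
have N1 : `|1 : R| <= 1 by rewrite normr1.
have NN1 : `|-1 : R| <= 1 by rewrite normrN normr1.
have [bU bU' _] := combP 1; have [bV bV' _] := combP (-1).
split.
  apply: is_trace_polar => //; try exact: hilbert_schmidt_half.
    exact: trace_class_comp PP QQ hP hQ exE.
  by move=> x /=; have [_ _ ->] := PP; rewrite combE.
rewrite /hs_norm !(hs_adjoint hdot bE bE (combP _)) -!/(hs_norm _ _).
apply: is_trace_polar => //; try exact: hilbert_schmidt_half.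
  exact: trace_class_comp QQ PP hQ hP exE.
move=> x /=; have [_ _ ->] := QQ; rewrite combE; congr (_ - _).
  by rewrite /comb scale1r scale1r addrC.
by rewrite /comb -normrN -scalerN opprD scaleN1r opprK scaleN1r addrC.
Qed.

(** As [A] is positive semidefinite, [|A| = A], and [dot (A e) e] is the squared norm of the square
    root at [e]: trace class for [A] means Hilbert-Schmidt for its root. *)
Lemma covariance_op_sqrt A : covariance_op dot A ->
  psd_op dot (sqrt_op dot A) /\ hilbert_schmidt (sqrt_op dot A) /\
  (exists E, orthonormal_basis dot E) /\
  forall x, sqrt_op dot A (sqrt_op dot A x) = A x.
Proof.
move=> [psdA [bA [E bE]]]; have [_ sA A0] := psdA.
rewrite /abs_op (adjoint_unique hdot sA) (sqrt_op_eq hdot psdA) // => trA.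
have [psdS SS] := sqrt_opP hdot psdA; have [bS sS _] := psdS.
split=> //; split; last by split=> //; exists E.
apply: (hilbert_schmidt_basis bE bS); rewrite /hs_norm.
by under eq_esum do rewrite -hdot sS SS dotC.
Qed.

End TraceClass.

(** * Maximal isometric graphs *)

Section Pushforward.
Context (R : realType) (H : completeNormedModType R) (dot : {dot H for idfun}).
Hypothesis hdot : induces_norm dot.
Implicit Types (A B K L S T W : H -> H) (D V : set H) (F : set (H * H)).

(** If [p] is the projection of [x] onto the closure of [D], then [x - p] lies in the closure of [V]
    and is orthogonal to [D], hence is 0. *)
Lemma orth_orth_subset D V : linear_subspace D -> D `<=` orth dot (orth dot V) ->
  (forall e, orth dot (orth dot V) e -> orth dot D e -> e = 0) ->
  orth dot (orth dot V) `<=` orth dot (orth dot D).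
Proof.
move=> subD DV De0 x Vx.
have [||v _|p [Dp px _]] :=
    @riesz_closure _ _ _ hdot D (fun v => dot v x) `|x| subD.
- by [].
- by move=> a u v _ _; rewrite !dotE.
- by rewrite mulrC; exact: dot_normM.
suff /subr0_eq -> : x - p = 0 by [].
apply: De0; last by move=> v Dv; rewrite dotBr px // subrr.
apply: orth_sub => //; move: p Dp {px}; apply: orthS => w Vw.
by apply: (orthS DV); exact: sub_orth_orth.
Qed.

Lemma isometric_graph_extend F e f : isometric_graph F ->
  orth dot (graph_dom F) e -> orth dot (graph_ran F) f -> `|e| = `|f| ->
  isometric_graph [set p | exists x y (t : R),
    F (x, y) /\ p = (x + t *: e, y + t *: f)].
Proof.
move=> isoF eF fF ef; have [F0 linF normF] := isoF; split.
- by exists 0, 0, 0; rewrite !scale0r !addr0.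
- move=> a _ _ _ _ [x [y [t [Fxy [-> ->]]]]] [x' [y' [t' [Fxy' [-> ->]]]]].
  exists (a *: x + x'), (a *: y + y'), (a * t + t'); split; first exact: linF.
  by rewrite !scalerDl !scalerDr !scalerA; congr (_, _); rewrite addrACA.
- move=> _ _ [x [y [t [Fxy [-> ->]]]]]; apply/eqP; rewrite -(@eqrXn2 _ 2) //.
  rewrite !(normD_sq hdot) !dotZr eF; last by exists y.
  by rewrite fF ?(normF _ _ Fxy) ?normrZ ?ef //; exists x.
Qed.

Lemma maximal_isometric_graph V1 V2 F0 : isometric_graph F0 ->
  F0 `<=` orth dot (orth dot V1) `*` orth dot (orth dot V2) ->
  exists F, [/\ isometric_graph F, F0 `<=` F,
    F `<=` orth dot (orth dot V1) `*` orth dot (orth dot V2) &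
    orth dot (orth dot V1) `<=` orth dot (orth dot (graph_dom F)) \/
    orth dot (orth dot V2) `<=` orth dot (orth dot (graph_ran F))].
Proof.
move=> isoF0 F0V; pose N := orth dot (orth dot V1) `*` orth dot (orth dot V2).
pose good F := [/\ isometric_graph F, F0 `<=` F & F `<=` N].
have [C CP Ctot|F [FP Fmax]] := @Zorn_bigcup _ [set F | F = set0 \/ good F].
  have [[G CG goodG]|nogood] := pselect (exists2 G, C G & good G); last first.
    left; apply/seteqP; split=> // p [G CG Gp].
    have [G0|goodG] := CP G CG; first by rewrite G0 in Gp.
    by exfalso; apply: nogood; exists G.
  right; split.
  - split.
    + by exists G => //; have [[]] := goodG.
    + move=> a x y x' y' [G1 C1 G1x] [G2 C2 G2y].
      have [G12|G21] := Ctot _ _ C1 C2.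
        exists G2 => //; have [G0|[[_ linG _] _ _]] := CP G2 C2.
          by rewrite G0 in G2y.
        by apply: linG => //; exact: G12.
      exists G1 => //; have [G0|[[_ linG _] _ _]] := CP G1 C1.
        by rewrite G0 in G1x.
      by apply: linG => //; exact: G21.
    + move=> x x' [G1 C1 G1x]; have [G0|[[_ _ normG] _ _]] := CP G1 C1.
        by rewrite G0 in G1x.
      exact: normG.
  - by move=> p F0p; exists G => //; have [_ + _] := goodG; exact.
  - move=> p [G1 C1 G1p]; have [G0|[_ _ GN]] := CP G1 C1; last exact: GN.
    by rewrite G0 in G1p.
have F00 : F0 (0, 0) by case: isoF0.
have [isoF F0F FN] : good F.
  case: FP => // F_eq0; exfalso; apply: (Fmax F0); last by right; split.
  by rewrite F_eq0; split=> [//|/(_ _ F00)].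
exists F; split=> //; have [Fzz linF normF] := isoF.
have subdom : linear_subspace (graph_dom F).
  split; first by exists 0.
  by move=> a x y [x' Fx] [y' Fy]; exists (a *: x' + y'); apply: linF.
have subran : linear_subspace (graph_ran F).
  split; first by exists 0.
  by move=> a x y [x' Fx] [y' Fy]; exists (a *: x' + y'); apply: linF.
have [/existsNP[e /not_implyP[Ve /not_implyP[Fe e0]]]|dom0] :=
    pselect (~ forall e, orth dot (orth dot V1) e -> orth dot (graph_dom F) e -> e = 0); last first.
  left; apply: orth_orth_subset => //; last exact: contrapT.
  by move=> x [y /FN[]].
right; apply: orth_orth_subset => //; first by move=> y [x /FN[]].
move=> f Vf Ff; apply: contrapT => /eqP f0; move/eqP in e0.
(* Scaling [f] to the norm of [e] makes the extension by [(e, c *: f)] isometric. *)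
pose c := `|e| / `|f|; have nf : `|f| != 0 by rewrite normr_eq0.
have ef : `|e| = `|c *: f|.
  by rewrite normrZ ger0_norm ?divr_ge0 // mulfVK.
have orthZ U (g : H) (t : R) : orth dot U g -> orth dot U (t *: g).
  by move=> Ug v Uv; rewrite dotZr Ug ?mulr0.
apply: (Fmax _ _ (or_intror (And3 (isometric_graph_extend isoF Fe (orthZ _ _ c Ff) ef) _ _))).
(* The extension is strict: otherwise [e] would lie in the domain, to which it is orthogonal. *)
- split=> [[x y] Fxy|]; first by exists x, y, 0; rewrite !scale0r !addr0.
  move=> /(_ (e, c *: f)) Fef; have {}Fef : F (e, c *: f).
    by apply: Fef; exists 0, 0, 1; rewrite !scale1r !add0r.
  by case/negP: e0; apply/eqP/(dotxx_eq0 hdot)/Fe; exists (c *: f).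
- by move=> [x y] F0xy; exists x, y, 0; rewrite !scale0r !addr0; split=> //; exact: F0F.
- move=> _ [x [y [t [Fxy ->]]]]; have [Vx Vy] := FN _ Fxy; split=> /=.
    by rewrite addrC; apply: orth_lin.
  by rewrite addrC; apply: orth_lin => //; exact: orthZ.
Qed.

(** The kernel condition makes [T] well defined on the range of [rA]. With [G = rB W'], [W' W = 1]
    on the range of [rB] gives [G G^* = B]. Self-adjointness gives [rA rB W' = W rB rA], whose
    square is [rA B rA]. *)
Lemma leadsto_intro A B W W' : covariance_op dot A -> covariance_op dot B ->
  let rA := sqrt_op dot A in let rB := sqrt_op dot B in
  adjoint_pair dot W W' -> (forall x, `|W x| <= `|x|) ->
  (forall y, W' (W (rB y)) = rB y) -> (forall z, rA z = 0 -> W' z = 0) ->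
  psd_op dot (fun x => W (rB (rA x))) -> leadsto dot A B.
Proof.
move=> cA cB rA rB WW W1 W'W W'0 psdM.
have [psdA [hA [exE AA]]] := covariance_op_sqrt hdot cA.
have [psdB [hB [_ BB]]] := covariance_op_sqrt hdot cB.
rewrite -/rA -/rB in psdA hA AA psdB hB BB.
have pA := psd_op_adjoint_pair psdA; have pB := psd_op_adjoint_pair psdB.
have [bW bW' adjW] := WW; have [[linW' _] [linA _]] := (bW', let: And3 b _ _ := pA in b).
have /boolp.choice[T hT] : forall y, exists z, forall x, y = rA x -> z = rB (W' x).
  move=> y; have [[x <-]|nx] := pselect (exists x, rA x = y); last first.
    by exists 0 => x yx; exfalso; apply: nx; exists x.
  exists (rB (W' x)) => x' xx'; congr rB; apply/eqP; rewrite -subr_eq0.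
  by rewrite -(linB linW') W'0 // (linB linA) xx' subrr.
have TA x : T (rA x) = rB (W' x) by exact: hT.
have pG := adjoint_pair_comp pB (adjoint_pair_sym WW).
have [bG bG' adjG] := pG.
have GE : T \o rA = rB \o W' by apply/funext => x /=.
have hG : hilbert_schmidt dot (rB \o W').
  apply: (hilbert_schmidt_adjoint hdot (adjoint_pair_sym pG)).
  by apply: hilbert_schmidt_le hB => x; exact: W1.
have ME x : rA (rB (W' x)) = W (rB (rA x)).
  have pM : adjoint_pair dot (fun x => W (rB (rA x))) (fun x => rA (rB (W' x))).
    exact: (adjoint_pair_comp WW (adjoint_pair_comp pB pA)).
  have [_ _ hM] := pM; have [_ sM _] := psdM.
  by apply: (dot_inj hdot) => z; rewrite dotC -hM sM dotC.
exists T; split.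
  split.
  - move=> a _ _ [x _ <-] [y _ <-]; rewrite -linA !TA linW'.
    by have [[linB' _] _ _] := psdB; rewrite linB'.
  - by rewrite -/rA GE.
  - rewrite -/rA GE (adjoint_unique hdot adjG); apply/funext => x /=.
    by rewrite W'W BB.
(* [rA G] and [G rA = T A] have the same trace, and [rA G] is itself the square root in the third
   condition. *)
have [t [tr1 tr2]] := is_trace_comp hdot pA pG hA hG exE; exists t; split.
- by rewrite -[_ \o _]/(rA \o (T \o rA)) GE.
- by rewrite (_ : T \o A = (rB \o W') \o rA) //; apply/funext => x /=; rewrite -AA TA.
- rewrite (_ : sqrt_op _ _ = rA \o (rB \o W')) //.
  rewrite (sqrt_op_eq hdot psdM) => [|x]; first by apply/funext => x; rewrite /= ME.
  by rewrite -ME W'W BB.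
Qed.

End Pushforward.

(** * The choice between the two directions *)

Theorem corollary6p6 (R : realType) (H : completeNormedModType R)
    (dot : {dot H for idfun}) (hdot : induces_norm dot) (hsep : separable H)
    (A B : H -> H) (hA : covariance_op dot A) (hB : covariance_op dot B) :
  leadsto dot A B \/ leadsto dot B A.
Proof.
have [psdA [_ [_ AA]]] := covariance_op_sqrt hdot hA.
have [psdB [_ [_ BB]]] := covariance_op_sqrt hdot hB.
set rA := sqrt_op dot A in psdA AA; set rB := sqrt_op dot B in psdB BB.
have [bA sA _] := psdA; have [bB sB _] := psdB.
have [linA _] := bA; have [linB _] := bB.
pose M x := rB (rA x).
have linM : linear M by move=> a x y; rewrite /M linA linB.
have psdMM : psd_op dot (fun x => rA (rB (M x))).
  split; first exact: (bounded_op_comp bA (bounded_op_comp bB (bounded_op_comp bB bA))).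
    by move=> x y; rewrite sA !sB sA.
  by move=> x; rewrite sA sB (dotxx_ge0 hdot).
have [psdS SS] := sqrt_opP hdot psdMM; move: (sqrt_op _ _) psdS SS => S psdS SS.
have [[linS _] symS S0] := psdS.
have normSM x : `|M x| = `|S x|.
  apply/eqP; rewrite -(@eqrXn2 _ 2) // -!hdot symS SS.
  by rewrite -sA -sB.
have ker_orth rK z : self_adjoint dot rK -> orth dot (range rK) z <-> rK z = 0.
  move=> sK; split=> [zK|Kz v [x _ <-]]; last by rewrite sK Kz dot0r.
  by apply: (dot_inj hdot) => x; rewrite sK dot0l dotC; apply: zK; exists x.
(* [S] vanishes on the kernel of [rA], which is the orthogonal complement of the range of [rA]. *)
have rangeS x : orth dot (orth dot (range rA)) (S x).
  move=> w /ker_orth => /(_ sA) Aw; rewrite -symS.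
  suff -> : S w = 0 by rewrite dot0l.
  by apply/eqP; rewrite -normr_eq0 -normSM /M Aw (lin0 linB) normr0.
pose F0 : set (H * H) := [set p | exists x, p = (M x, S x)].
have isoF0 : isometric_graph F0.
  split; first by exists 0; rewrite (lin0 linM) (lin0 linS).
    move=> a x y x' y' [u [-> ->]] [v [-> ->]]; exists (a *: u + v).
    by rewrite linM linS.
  by move=> x x' [u [-> ->]].
have [|F [isoF F0F FN Fmax]] :=
    @maximal_isometric_graph _ _ _ hdot (range rB) (range rA) F0 isoF0.
  move=> _ [x ->]; split; last exact: rangeS.
  by apply: sub_orth_orth; exists (rA x).
case: Fmax => [domF|ranF]; [left | right].
  have [W [W' [WW W1 [WF W'W W'0]]]] := isometry_extension hdot isoF.
  have WM x : W (M x) = S x by apply/WF/F0F; exists x.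
  apply: (leadsto_intro hdot hA hB WW W1) => [y|z /(ker_orth _ z sA) Az|].
  - by apply/W'W/domF/sub_orth_orth; exists y.
  - by apply: W'0 => y [x /FN[_ /(_ _ Az)]]; rewrite dotC.
  - by rewrite (_ : (fun _ => _) = S) //; apply/funext => x; exact: WM.
(* The inverse graph: its extension [W] carries [S x] back to [M x]. *)
pose Fi : set (H * H) := [set p | F (p.2, p.1)].
have isoFi : isometric_graph Fi.
  have [F00 linF normF] := isoF.
  by split=> [//|a x y x' y'|x x' /normF] //; exact: linF.
have [W [W' [WW W1 [WF W'W W'0]]]] := isometry_extension hdot isoFi.
have WS x : W (S x) = M x by apply/WF/F0F; exists x.
have [bW bW' adjW] := WW.
(* The adjoint of [W S = M]. *)
have SW' x : S (W' x) = rA (rB x).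
  by apply: (dot_inj hdot) => y; rewrite symS dotC -adjW WS dotC /M -sB -sA.
apply: (leadsto_intro hdot hB hA WW W1) => [y|z /(ker_orth _ z sB) Bz|].
- by apply/W'W/ranF/sub_orth_orth; exists y.
- by apply: W'0 => x [y /FN[/(_ _ Bz)]]; rewrite dotC.
(* A conjugate of [S], hence positive semidefinite. *)
- rewrite (_ : (fun _ => _) = W \o S \o W'); last by apply/funext => x; rewrite /= SW'.
  split=> [|x y|x] /=; last by rewrite adjW.
    by apply: bounded_op_comp => //; apply: bounded_op_comp => //; case: psdS.
  by rewrite adjW symS [RHS]dotC adjW dotC.
Qed.
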